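(* Let $\mathbb{V}=U\oplus W$ be a finite-dimensional vector space over a field $\mathcal{F}$, where $U$ and $W$ are nonzero subspaces and $\dim(\mathbb{V})>1$. Then the direct sum graph $\Gamma_{U\oplus W}(\mathbb{V})$ is complete if and only if $\dim(\mathbb{V})=2$.
   Context: Let $\mathbb{V}$ be a vector space over a field $\mathcal{F}$ with $\mathbb{V}=U\oplus W$, where $U,W$ are nonzero subspaces, $\dim U=r$, $\dim W=s$, $r+s=n=\dim\mathbb{V}$. Fix a basis $\{\alpha_1,\dots,\alpha_r\}$ of $U$ and a basis $\{\beta_1,\dots,\beta_s\}$ of $W$; every $x\in\mathbb{V}$ is written uniquely as $x=a_1\alpha_1+\dots+a_r\alpha_r+b_1\beta_1+\dots+b_s\beta_s$. The direct sum graph $\Gamma_{U\oplus W}(\mathbb{V})$ is the simple graph whose vertex set is $\{x=u+w: u\in U, w\in W, u\neq 0, w\neq 0\}$, in which two distinct vertices $x,y$ are adjacent iff there is an index $i$ such that the coefficient of $\alpha_i$ is nonzero in both $x$ and $y$, and there is an index $j$ such that the coefficient of $\beta_j$ is nonzero in both $x$ and $y$. *)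

(* Defs.v *)
From mathcomp Require Import all_boot all_order all_algebra.

Set Implicit Arguments.
Unset Strict Implicit.
Unset Printing Implicit Defensive.

Import GRing.Theory.
Local Open Scope ring_scope.

(* The carrier T is an ambient type, possibly infinite: only the elements
   satisfying [vertex] belong to the graph. *)
Record sgraph (T : Type) := SGraph {
  vertex : T -> Prop;
  adj : T -> T -> Prop;
  adj_vertex : forall x y, adj x y -> vertex x;
  adj_sym : forall x y, adj x y -> adj y x;
  adj_irrefl : forall x, ~ adj x x
}.

Definition complete (T : Type) (G : sgraph T) : Prop :=
  forall x y, vertex G x -> vertex G y -> x <> y -> adj G x y.

Section DirectSumGraph.

Variables (F : fieldType) (V : vectType F) (U W : {vspace V}) (r s : nat).
Variables (alpha : r.-tuple V) (beta : s.-tuple V).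

(* Coefficients of x in the concatenated family alpha ++ beta; they are the
   intended ones when that family is a basis of V, i.e., when alpha and beta
   are bases of the two summands of V = U (+) W. *)
Definition coefU (i : 'I_r) (x : V) : F :=
  coord (cat_tuple alpha beta) (lshift s i) x.

Definition coefW (j : 'I_s) (x : V) : F :=
  coord (cat_tuple alpha beta) (rshift r j) x.

Definition dsg_vertex (x : V) : Prop :=
  exists u w : V, [/\ u \in U, w \in W, u != 0, w != 0 & x = u + w].

Definition dsg_adj (x y : V) : Prop :=
  [/\ dsg_vertex x, dsg_vertex y, x <> y,
      exists i : 'I_r, coefU i x != 0 /\ coefU i y != 0
    & exists j : 'I_s, coefW j x != 0 /\ coefW j y != 0].

Fact dsg_adj_vertex x y : dsg_adj x y -> dsg_vertex x.
Proof. by case. Qed.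

Fact dsg_adj_sym x y : dsg_adj x y -> dsg_adj y x.
Proof.
case=> vx vy nxy [i [ix iy]] [j [jx jy]]; split=> //; first exact: nesym.
  by exists i.
by exists j.
Qed.

Fact dsg_adj_irrefl x : ~ dsg_adj x x.
Proof. by case=> _ _ /(_ erefl). Qed.

Definition direct_sum_graph : sgraph V :=
  SGraph dsg_adj_vertex dsg_adj_sym dsg_adj_irrefl.

End DirectSumGraph.

(* Main.v *)
Require Import Defs.
From mathcomp Require Import all_boot all_order all_algebra.

(* The supports of the vertices alpha_i + beta_j and alpha_i' + beta_j' meet
   in both blocks only if i = i' and j = j', so completeness forces r = s = 1.
   Conversely, if r = s = 1 then every vertex has both of its coefficients
   nonzero. *)

Set Implicit Arguments.
Unset Strict Implicit.

Import GRing.Theory.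

Local Open Scope ring_scope.

Section CatCoord.

Variables (F : fieldType) (V : vectType F) (r s : nat).
Variables (X : r.-tuple V) (Y : s.-tuple V).
Hypothesis freeXY : free (cat_tuple X Y).

(** The sum over ['I_(r + s)] splits into its two blocks, on which the concatenated family restricts
    to [X] and to [Y]; each block is then the expansion of [u] or of [w]. *)
Let cat_decomposition (u w : V) (c : 'I_(r + s) -> F) :
    u \in <<X>>%VS -> w \in <<Y>>%VS ->
    (forall i, c (lshift s i) = coord X i u) ->
    (forall j, c (rshift r j) = coord Y j w) ->
  u + w = \sum_k c k *: (cat_tuple X Y)`_k.
Proof.
move=> Xu Yw cX cY; rewrite big_split_ord /= {1}(coord_span Xu)
  {1}(coord_span Yw).
congr (_ + _); apply: eq_bigr => i _.
  by rewrite cX nth_cat size_tuple ltn_ord.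
by rewrite cY nth_cat size_tuple ltnNge leq_addr addKn.
Qed.

(** Glues the two coordinate families into a single coefficient function, the form in which
    uniqueness of expansions in a free family applies. *)
Let cat_coef (u w : V) (k : 'I_(r + s)) : F :=
  match split k with inl i => coord X i u | inr j => coord Y j w end.

Let cat_coefl u w i : cat_coef u w (lshift s i) = coord X i u.
Proof. by rewrite /cat_coef (unsplitK (inl i)). Qed.

Let cat_coefr u w j : cat_coef u w (rshift r j) = coord Y j w.
Proof. by rewrite /cat_coef (unsplitK (inr j)). Qed.

(** Coefficients in a free family are unique, so they can be read off the glued expansion of
    [u + w]. *)
Lemma coord_catl (u w : V) (i : 'I_r) :
    u \in <<X>>%VS -> w \in <<Y>>%VS ->
  coord (cat_tuple X Y) (lshift s i) (u + w) = coord X i u.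
Proof.
move=> Xu Yw.
rewrite (cat_decomposition Xu Yw (cat_coefl u w) (cat_coefr u w)).
by rewrite coord_sum_free.
Qed.

Lemma coord_catr (u w : V) (j : 'I_s) :
    u \in <<X>>%VS -> w \in <<Y>>%VS ->
  coord (cat_tuple X Y) (rshift r j) (u + w) = coord Y j w.
Proof.
move=> Xu Yw.
rewrite (cat_decomposition Xu Yw (cat_coefl u w) (cat_coefr u w)).
by rewrite coord_sum_free.
Qed.

End CatCoord.

Lemma coord_neq0 (F : fieldType) (V : vectType F) (n : nat) (X : n.-tuple V) (v : V) :
  v \in <<X>>%VS -> v != 0 -> exists i, coord X i v != 0.
Proof.
move=> Xv nz_v; apply/existsP; apply: contraNT nz_v => /existsPn coord0.
rewrite (coord_span Xv) big1 // => i _.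
by rewrite (eqP (negPn (coord0 i))) scale0r.
Qed.

Section DirectSumGraphCoef.

Variables (F : fieldType) (V : vectType F) (U W : {vspace V}) (r s : nat).
Variables (alpha : r.-tuple V) (beta : s.-tuple V).
Hypothesis directUW : directv (U + W).
Hypotheses (basis_alpha : basis_of U alpha) (basis_beta : basis_of W beta).

Let free_cat : free (cat_tuple alpha beta).
Proof. exact: basis_free (cat_basis directUW basis_alpha basis_beta). Qed.

(** Reduces the coefficients that define adjacency to coordinates inside one summand. *)
Lemma coefU_add (i : 'I_r) (u w : V) :
  u \in U -> w \in W -> coefU alpha beta i (u + w) = coord alpha i u.
Proof.
move=> Uu Ww; apply: coord_catl => //.
  by rewrite (span_basis basis_alpha).
by rewrite (span_basis basis_beta).
Qed.

Lemma coefW_add (j : 'I_s) (u w : V) :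
  u \in U -> w \in W -> coefW alpha beta j (u + w) = coord beta j w.
Proof.
move=> Uu Ww; apply: coord_catr => //.
  by rewrite (span_basis basis_alpha).
by rewrite (span_basis basis_beta).
Qed.

Let alphaU (i : 'I_r) : alpha`_i \in U.
Proof. by rewrite (basis_mem basis_alpha) // mem_nth // size_tuple. Qed.

Let betaW (j : 'I_s) : beta`_j \in W.
Proof. by rewrite (basis_mem basis_beta) // mem_nth // size_tuple. Qed.

Lemma basis_sum_vertex (i : 'I_r) (j : 'I_s) :
  dsg_vertex U W (alpha`_i + beta`_j).
Proof.
exists alpha`_i, beta`_j; split=> //.
  by rewrite (free_not0 (basis_free basis_alpha)) // mem_nth // size_tuple.
by rewrite (free_not0 (basis_free basis_beta)) // mem_nth // size_tuple.
Qed.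

Lemma coefU_basis_sum (k i : 'I_r) (j : 'I_s) :
  coefU alpha beta k (alpha`_i + beta`_j) = (i == k)%:R.
Proof. by rewrite coefU_add // coord_free // (basis_free basis_alpha). Qed.

Lemma coefW_basis_sum (k j : 'I_s) (i : 'I_r) :
  coefW alpha beta k (alpha`_i + beta`_j) = (j == k)%:R.
Proof. by rewrite coefW_add // coord_free // (basis_free basis_beta). Qed.

(** Varying only the first pair of indices will bound [r], and varying only the second will bound
    [s]. *)
Lemma complete_index_unique (i i' : 'I_r) (j j' : 'I_s) :
  complete (direct_sum_graph U W alpha beta) -> i = i' /\ j = j'.
Proof.
move=> /(_ _ _ (basis_sum_vertex i j) (basis_sum_vertex i' j')) adj_xy.
have nz_natb (b : bool) : (b%:R != 0 :> F) = b by case: b; rewrite ?oner_eq0 ?eqxx.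
have [eq_xy | /eqP/adj_xy[_ _ _ [k []]]] :=
  eqVneq (alpha`_i + beta`_j) (alpha`_i' + beta`_j').
  (* If the two vertices coincide, completeness says nothing; instead, comparing their coefficients
     at [i] and at [j] shows that both Kronecker deltas equal 1, which is nonzero in [F]. *)
  have := coefU_basis_sum i i j; have := coefW_basis_sum j j i.
  rewrite eq_xy coefU_basis_sum coefW_basis_sum !eqxx => eqj eqi.
  by split; apply/esym/eqP;
    [rewrite -(nz_natb (i' == i)) eqi | rewrite -(nz_natb (j' == j)) eqj];
    exact: oner_neq0.
(* For distinct vertices, the shared index [k] must be both [i] and [i'], and the shared index [l]
   both [j] and [j']. *)
rewrite !coefU_basis_sum !nz_natb => /eqP-> /eqP-> [l []].
by rewrite !coefW_basis_sum !nz_natb => /eqP-> /eqP->.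
Qed.

(** The component of a vertex in [U] is nonzero, hence has a nonzero coordinate in [alpha]. *)
Lemma vertex_coefU (x : V) :
  dsg_vertex U W x -> exists i, coefU alpha beta i x != 0.
Proof.
case=> u [w [Uu Ww nz_u _ ->]].
have [|i nz_i] := coord_neq0 (X := alpha) (v := u) _ nz_u.
  by rewrite (span_basis basis_alpha).
by exists i; rewrite coefU_add.
Qed.

Lemma vertex_coefW (x : V) :
  dsg_vertex U W x -> exists j, coefW alpha beta j x != 0.
Proof.
case=> u [w [Uu Ww _ nz_w ->]].
have [|j nz_j] := coord_neq0 (X := beta) (v := w) _ nz_w.
  by rewrite (span_basis basis_beta).
by exists j; rewrite coefW_add.
Qed.

End DirectSumGraphCoef.

Unset Implicit Arguments.
Set Strict Implicit.

Theorem theorem2p2 (F : fieldType) (V : vectType F) (U W : {vspace V})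
    (r s : nat) (alpha : r.-tuple V) (beta : s.-tuple V)
    (sumUW : (U + W)%VS = fullv) (directUW : directv (U + W))
    (U_neq0 : U != 0%VS) (W_neq0 : W != 0%VS)
    (basis_alpha : basis_of U alpha) (basis_beta : basis_of W beta)
    (dimV_gt1 : (1 < \dim {:V})%N) :
  complete (direct_sum_graph U W alpha beta) <-> \dim {:V} = 2%N.
Proof.
have dimU : \dim U = r by rewrite -(size_basis basis_alpha).
have dimW : \dim W = s by rewrite -(size_basis basis_beta).
have -> : \dim {:V} = (r + s)%N by rewrite -sumUW (directvP directUW) /= dimU dimW.
have r_gt0 : (0 < r)%N by rewrite lt0n -dimU dimv_eq0.
have s_gt0 : (0 < s)%N by rewrite lt0n -dimW dimv_eq0.
split=> [complG | rs2].
  have idx := complete_index_unique directUW basis_alpha basis_beta _ _ _ _ complG.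
  have r_le1 : (r <= 1)%N.
    (* Otherwise 0 and 1 are two distinct indices into [alpha], which [idx] would identify. *)
    rewrite leqNgt; apply/negP => r_gt1.
    have [] := idx (Ordinal r_gt0) (Ordinal r_gt1) (Ordinal s_gt0) (Ordinal s_gt0).
    by move/(congr1 val).
  have s_le1 : (s <= 1)%N.
    rewrite leqNgt; apply/negP => s_gt1.
    have [] := idx (Ordinal r_gt0) (Ordinal r_gt0) (Ordinal s_gt0) (Ordinal s_gt1).
    by move=> _ /(congr1 val).
  by apply/eqP; rewrite eqn_leq (leq_add r_le1 s_le1) (leq_add r_gt0 s_gt0).
(* After adding [s] to both sides, [r <= 1] becomes [2 <= 1 + s], which is [s_gt0]. *)
have r1 : r = 1%N by apply/eqP; rewrite eqn_leq r_gt0 andbT -(leq_add2r s) rs2.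
have s1 : s = 1%N by move: rs2; rewrite r1 => -[].
move=> x y vx vy neq_xy.
have [i xi] := vertex_coefU directUW basis_alpha basis_beta vx.
have [i' yi] := vertex_coefU directUW basis_alpha basis_beta vy.
have [j xj] := vertex_coefW directUW basis_alpha basis_beta vx.
have [j' yj] := vertex_coefW directUW basis_alpha basis_beta vy.
(* Stated for an arbitrary [n], which can be replaced by 1 without touching the types of [alpha] and
   [beta]. *)
have ord_unique n (k k' : 'I_n) : n = 1%N -> k = k'.
  by move=> n1; move: k k'; rewrite n1 => k k'; rewrite (ord1 k) (ord1 k').
rewrite (ord_unique _ i' i r1) in yi; rewrite (ord_unique _ j' j s1) in yj.
by split=> //; [exists i | exists j].
Qed.
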